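(* Let $\Gamma=(m_{i,j})_{i,j\in I}$ be a Coxeter matrix, and let $\tilde I$ be an LCM-partition of $\Gamma$, of type $\Omega=(n_{\alpha,\beta})_{\alpha,\beta\in\tilde I}$. Then $\tilde I$ is an admissible partition of $\Gamma$, and $\Omega=\tilde\Gamma=(|r_\alpha r_\beta|)_{\alpha,\beta\in\tilde I}$, i.e. $n_{\alpha,\beta}$ is the order of $r_\alpha r_\beta$ in $W_\Gamma$ for all $\alpha,\beta\in\tilde I$.
   Context: A Coxeter matrix over an arbitrary (possibly infinite) set $I$ is a family $\Gamma=(m_{i,j})_{i,j\in I}$ with $m_{i,j}=m_{j,i}\in\mathbb N_{\geq 1}\cup\{\infty\}$ and $m_{i,j}=1\iff i=j$. For $n\in\mathbb N$, $\prod_n(x,y)$ is the alternating product $xyxy\cdots$ with $n$ factors starting with $x$. $W_\Gamma$ is the Coxeter group generated by $s_i$ ($i\in I$) with relations $s_i^2=1$ and $\prod_{m_{i,j}}(s_i,s_j)=\prod_{m_{i,j}}(s_j,s_i)$ if $m_{i,j}\ne\infty$. $B^+_\Gamma$ is the monoid presented by generators $\mathbf s_i$ ($i\in I$) and relations $\prod_{m_{i,j}}(\mathbf s_i,\mathbf s_j)=\prod_{m_{i,j}}(\mathbf s_j,\mathbf s_i)$ for $m_{i,j}\neq\infty$. $\ell$ denotes word length on $W_\Gamma$ with respect to $\{s_i\}$. For $w\in W_\Gamma$, $\mathbf w\in B^+_\Gamma$ is the element represented by any reduced word of $w$ (well defined by Tits' theorem). For $J\subseteq I$, $\Gamma_J=(m_{i,j})_{i,j\in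 J}$ and $W_J=\langle s_j\mid j\in J\rangle$. $J$ (or $\Gamma_J$) is spherical if $W_J$ is finite; then $r_J$ is the unique element of maximal length in $W_J$ and $\mathbf r_J\in B^+_\Gamma$ is the corresponding element. A partition $\tilde I$ of $I$ (into non-empty parts) is spherical if every $\alpha\in\tilde I$ is spherical; then $\tilde W=\langle r_\alpha\mid\alpha\in\tilde I\rangle\subseteq W_\Gamma$. For $w\in W_\Gamma$, put $I^{\pm}(w)=\{i\in I\mid \ell(ws_i)=\ell(w)\pm1\}$. The partition $\tilde I$ is admissible if it is spherical and for all $(w,\alpha)\in\tilde W\times\tilde I$ either $\alpha\subseteq I^+(w)$ or $\alpha\subseteq I^-(w)$. Let $\tilde I$ be a spherical partition of $\Gamma$ and $\Omega=(n_{\alpha,\beta})_{\alpha,\beta\in\tilde I}$ a Coxeter matrix over $\tilde I$. $\tilde I$ is an LCM-partition of $\Gamma$ of type $\Omega$ if for each pair $(\alpha,\beta)\in\tilde I^2$ one of the following holds: (Fi) $n_{\alpha,\beta}\neq\infty$, $\Gamma_{\alpha\cup\beta}$ is spherical and $\mathbf r_{\alpha\cup\beta}=\prod_{n_{\alpha,\beta}}(\mathbf r_\alpha,\mathbf r_\beta)$; (In) $n_{\alpha,\beta}=\infty$ and for all $i\in\alpha$, $\Gamma_{\{i\}\cup\beta}$ is non-spherical. *)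

(* Defs.v *)
From HB Require Import structures.
From mathcomp Require Import all_boot.
From mathcomp Require Import boolp classical_sets functions cardinality.

Set Implicit Arguments.
Unset Strict Implicit.
Unset Printing Implicit Defensive.

Local Open Scope quotient_scope.
Local Open Scope classical_set_scope.
Local Open Scope group_scope.

(* [pres_monoid R] is the monoid presented by the generators [X] and the
   relations [u = v] for [R u v], with words encoded as sequences. *)
Section PresentedMonoid.
Variables (X : Type) (R : seq X -> seq X -> Prop).

Inductive pres_cong : seq X -> seq X -> Prop :=
| PresRel u v a b : R u v -> pres_cong (a ++ u ++ b) (a ++ v ++ b)
| PresRefl u : pres_cong u u
| PresSym u v : pres_cong u v -> pres_cong v u
| PresTrans v u w : pres_cong u v -> pres_cong v w -> pres_cong u w.

Definition pres_congb : rel {classic seq X} := fun u v => `[< pres_cong u v >].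

Fact pres_congb_refl : reflexive pres_congb.
Proof. by move=> u; apply/asboolP; exact: PresRefl. Qed.

Fact pres_congb_sym : symmetric pres_congb.
Proof. by move=> u v; apply/asboolP/asboolP; exact: PresSym. Qed.

Fact pres_congb_trans : transitive pres_congb.
Proof.
by move=> v u w /asboolP uv /asboolP vw; apply/asboolP; exact: PresTrans vw.
Qed.

Canonical pres_congb_equiv :=
  EquivRel pres_congb pres_congb_refl pres_congb_sym pres_congb_trans.

Definition pres_monoid := {eq_quot pres_congb}.

HB.instance Definition _ := Choice.on pres_monoid.
HB.instance Definition _ := Quotient.on pres_monoid.

Definition pres_word (u : seq X) : pres_monoid := \pi_pres_monoid u.
Definition pres_gen (x : X) : pres_monoid := pres_word [:: x].

Lemma pres_wordP u v : pres_word u = pres_word v <-> pres_cong u v.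
Proof.
split; first by move=> /eqquotP /asboolP.
by move=> uv; apply/eqquotP/asboolP.
Qed.

Lemma pres_word_surj (x : pres_monoid) : exists u, x = pres_word u.
Proof. by exists (repr x); rewrite /pres_word reprK. Qed.

Lemma pres_cong_cat u u' v v' :
  pres_cong u u' -> pres_cong v v' -> pres_cong (u ++ v) (u' ++ v').
Proof.
have catl a w w' : pres_cong w w' -> pres_cong (a ++ w) (a ++ w').
  elim=> {w w'} [w w' b c Rw|w|w w' _|w' w w2 _ IH1 _ IH2].
  - by rewrite !(catA a b); exact: PresRel.
  - exact: PresRefl.
  - exact: PresSym.
  - exact: PresTrans IH1 IH2.
have catr a w w' : pres_cong w w' -> pres_cong (w ++ a) (w' ++ a).
  elim=> {w w'} [w w' b c Rw|w|w w' _|w' w w2 _ IH1 _ IH2].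
  - by rewrite -!catA; exact: PresRel.
  - exact: PresRefl.
  - exact: PresSym.
  - exact: PresTrans IH1 IH2.
by move=> uu' vv'; apply: PresTrans (catr _ _ _ uu') (catl _ _ _ vv').
Qed.

Definition pres_one : pres_monoid := pres_word [::].
Definition pres_mul (x y : pres_monoid) : pres_monoid :=
  pres_word ((repr x : seq X) ++ (repr y : seq X)).

Lemma pres_mulE u v : pres_mul (pres_word u) (pres_word v) = pres_word (u ++ v).
Proof.
by apply/pres_wordP; apply: pres_cong_cat; apply/pres_wordP;
  rewrite /pres_word reprK.
Qed.

Fact pres_mulA : associative pres_mul.
Proof.
move=> x y z; have [u ->] := pres_word_surj x; have [v ->] := pres_word_surj y.
by have [w ->] := pres_word_surj z; rewrite !pres_mulE catA.
Qed.

Fact pres_mul1 : left_id pres_one pres_mul.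
Proof. by move=> x; have [u ->] := pres_word_surj x; rewrite pres_mulE. Qed.

Fact pres_mulr1 : right_id pres_one pres_mul.
Proof. by move=> x; have [u ->] := pres_word_surj x; rewrite pres_mulE cats0. Qed.

HB.instance Definition _ := isMonoid.Build pres_monoid
  pres_mulA pres_mul1 pres_mulr1.

Lemma pres_wordM u v : pres_word (u ++ v) = pres_word u * pres_word v.
Proof. by rewrite -pres_mulE. Qed.

End PresentedMonoid.

(* A signed letter [(x, true)] stands for [x] and [(x, false)] for [x^-1];
   [pres_group R] is the group presented by [X] and the relations [R] between
   signed words, i.e. the monoid presented by the signed letters, [R], and the
   free cancellations. *)
Section PresentedGroup.
Variables (X : Type) (R : seq (X * bool) -> seq (X * bool) -> Prop).

Inductive grp_rel : seq (X * bool) -> seq (X * bool) -> Prop :=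
| GrpCancel x b : grp_rel [:: (x, b); (x, ~~ b)] [::]
| GrpRel u v : R u v -> grp_rel u v.

Definition pres_group := pres_monoid grp_rel.

HB.instance Definition _ := Monoid.on pres_group.

Definition inv_word (u : seq (X * bool)) : seq (X * bool) :=
  rev [seq (p.1, ~~ p.2) | p <- u].

Definition pres_inv (x : pres_group) : pres_group :=
  pres_word grp_rel (inv_word (repr x)).

Lemma inv_wordK : involutive inv_word.
Proof.
move=> u; rewrite /inv_word map_rev revK -map_comp -[RHS]map_id.
by apply: eq_map => -[x b] /=; rewrite negbK.
Qed.

Lemma mul_inv_word u :
  pres_word grp_rel u * pres_word grp_rel (inv_word u) = 1.
Proof.
rewrite -pres_wordM; apply/pres_wordP.
elim: u => [|[x b] u IH]; first exact: PresRefl.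
rewrite /inv_word /= rev_cons -cats1 catA -cat1s.
have := pres_cong_cat (PresRefl grp_rel [:: (x, b)])
         (pres_cong_cat IH (PresRefl grp_rel [:: (x, ~~ b)])).
move/PresTrans; rewrite !cat0s; apply.
exact: (@PresRel _ grp_rel _ _ [::] [::] (GrpCancel x b)).
Qed.

Fact pres_mulgV : right_inverse 1 pres_inv (@mul pres_group).
Proof.
move=> x; have {1}-> : x = pres_word grp_rel (repr x).
  by rewrite /pres_word reprK.
exact: mul_inv_word.
Qed.

Fact pres_mulVg : left_inverse 1 pres_inv (@mul pres_group).
Proof.
move=> x; have {2}-> : x = pres_word grp_rel (inv_word (inv_word (repr x))).
  by rewrite inv_wordK /pres_word reprK.
exact: mul_inv_word.
Qed.

HB.instance Definition _ := hasInv.Build pres_group pres_inv.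
HB.instance Definition _ := Monoid_isGroup.Build pres_group
  pres_mulVg pres_mulgV.

End PresentedGroup.

Fixpoint altprod (M : baseUMagmaType) (n : nat) (x y : M) : M :=
  if n is n'.+1 then x * altprod n' y x else 1.

Fixpoint altword (X : Type) (n : nat) (x y : X) : seq X :=
  if n is n'.+1 then x :: altword n' y x else [::].

Lemma pres_altword (X : Type) (R : seq X -> seq X -> Prop) n x y :
  pres_word R (altword n x y) = altprod n (pres_gen R x) (pres_gen R y).
Proof. by elim: n x y => //= n IH x y; rewrite -IH -pres_wordM. Qed.

(* [None] encodes the entry infinity. *)
Record coxeterMatrix (I : Type) := CoxeterMatrix {
  coxeter_entry :> I -> I -> option nat;
  coxeter_sym : forall i j, coxeter_entry i j = coxeter_entry j i;
  coxeter_gt0 : forall i j, coxeter_entry i j <> Some 0%N;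
  coxeter_diag : forall i j, coxeter_entry i j = Some 1%N <-> i = j }.

Definition subgroup_gen (G : groupType) (A : set G) : set G :=
  smallest (fun H : set G => group_closed (mem H)) A.

(* [None] encodes infinite order. *)
Definition elt_order (G : groupType) (g : G) : option nat :=
  if pselect (exists n, (0 < n)%N && (g ^+ n == 1)) is left ex
  then Some (ex_minn ex) else None.

Section Coxeter.
Variables (I : Type) (Gam : coxeterMatrix I).

Inductive coxeter_rel : seq (I * bool) -> seq (I * bool) -> Prop :=
| CoxeterSquare i : coxeter_rel [:: (i, true); (i, true)] [::]
| CoxeterBraid i j n : Gam i j = Some n ->
    coxeter_rel (altword n (i, true) (j, true)) (altword n (j, true) (i, true)).

Definition coxeter_group := pres_group coxeter_rel.

HB.instance Definition _ := Group.on coxeter_group.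

Definition cox_gen (i : I) : coxeter_group := pres_gen _ (i, true).

Definition cox_word (u : seq I) : coxeter_group :=
  \big[*%g/1]_(i <- u) cox_gen i.

Inductive artin_rel : seq I -> seq I -> Prop :=
| ArtinBraid i j n : Gam i j = Some n ->
    artin_rel (altword n i j) (altword n j i).

Definition artin_monoid := pres_monoid artin_rel.

HB.instance Definition _ := Monoid.on artin_monoid.

Definition artin_gen (i : I) : artin_monoid := pres_gen _ i.

Definition artin_word (u : seq I) : artin_monoid :=
  \big[*%g/1]_(i <- u) artin_gen i.

Lemma cox_word_surj (w : coxeter_group) : exists u, cox_word u = w.
Proof.
have [v ->] := pres_word_surj w; elim: v => [|[i b] v [u IH]].
  by exists [::]; rewrite /cox_word big_nil.
exists (i :: u); rewrite /cox_word big_cons -/(cox_word u) IH.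
rewrite -[RHS]/(pres_word _ ([:: (i, b)] ++ v)) pres_wordM; congr (_ * _).
case: b => //; apply/pres_wordP.
set cng := pres_cong _.
have e : cng [:: (i, true); (i, true); (i, false)] [:: (i, true)].
  exact: (@PresRel _ (grp_rel coxeter_rel) _ _ [:: (i, true)] [::]
    (GrpCancel _ i true)).
apply: PresTrans (PresSym e) _.
exact: (@PresRel _ (grp_rel coxeter_rel) _ _ [::] [:: (i, false)]
  (GrpRel (CoxeterSquare i))).
Qed.

Fact cox_length_ex (w : coxeter_group) :
  exists n, `[< exists u, cox_word u = w /\ size u = n >].
Proof. by have [u uw] := cox_word_surj w; exists (size u); apply/asboolP; exists u. Qed.

Definition cox_length (w : coxeter_group) : nat := ex_minn (cox_length_ex w).

Definition reduced_word_of (w : coxeter_group) : set (seq I) :=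
  [set u | cox_word u = w /\ size u = cox_length w].

Fact reduced_word_ex (w : coxeter_group) : exists u, reduced_word_of w u.
Proof. by rewrite /reduced_word_of /cox_length; case: ex_minnP => n /asboolP. Qed.

(* The element of the Artin monoid represented by a reduced word of [w]; by
   Tits' theorem it does not depend on the reduced word that [cid] selects. *)
Definition artin_lift (w : coxeter_group) : artin_monoid :=
  artin_word (projT1 (cid (reduced_word_ex w))).

Definition parabolic (J : set I) : set coxeter_group :=
  subgroup_gen (cox_gen @` J).

Definition spherical (J : set I) : Prop := finite_set (parabolic J).

(* Only meaningful for spherical [J], where the element of maximal length in
   the parabolic subgroup exists and is unique; [1] is a dummy default. *)
Definition longest (J : set I) : coxeter_group :=
  xget 1 [set w | parabolic J w /\
    forall v, parabolic J v -> (cox_length v <= cox_length w)%N].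

Definition artin_longest (J : set I) : artin_monoid := artin_lift (longest J).

Definition ascents (w : coxeter_group) : set I :=
  [set i | cox_length (w * cox_gen i) = (cox_length w).+1].

(* Length [cox_length w - 1], written without truncated subtraction. *)
Definition descents (w : coxeter_group) : set I :=
  [set i | (cox_length (w * cox_gen i)).+1 = cox_length w].

Definition spherical_partition (P : set (set I)) : Prop :=
  partition P id [set: I] /\ forall alpha, P alpha -> spherical alpha.

Definition partition_group (P : set (set I)) : set coxeter_group :=
  subgroup_gen (longest @` P).

Definition admissible_partition (P : set (set I)) : Prop :=
  spherical_partition P /\
  forall w alpha, partition_group P w -> P alpha ->
    alpha `<=` ascents w \/ alpha `<=` descents w.

(* [Om] is indexed by the parts, i.e. by the subtype of [set I] cut out by
   [P]. *)
Definition LCM_partition (P : set (set I)) (Om : coxeterMatrix P) : Prop :=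
  spherical_partition P /\
  forall alpha beta : P,
    (exists n, [/\ Om alpha beta = Some n,
       spherical (val alpha `|` val beta) &
       artin_longest (val alpha `|` val beta) =
         altprod n (artin_longest (val alpha)) (artin_longest (val beta))])
    \/
    (Om alpha beta = None /\
     forall i, val alpha i -> ~ spherical ([set i] `|` val beta)).

Definition partition_matrix (P : set (set I)) (alpha beta : P) : option nat :=
  elt_order (longest (val alpha) * longest (val beta)).

End Coxeter.

(* Main.v *)
(* Everything is done with left multiplication; the theorem follows by taking
   inverses.

   W satisfies the exchange condition. Hence, if J consists of left ascents of
   v, then l(xv) = l(x) + l(v) for x in W_J; if J consists of left descents of
   w, then l(w) = l(y) + l(y^-1 w) for y in W_J.

   For parts A, B with n = n_{A,B}, no element of A is a left descent of the
   alternating product of m factors r_B r_A r_B ..., for every m < n. For n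
   finite, the Artin monoid is graded, so (Fi) says that the alternating product
   of n factors has the sum of the lengths of its factors as length, in both
   orders. For n infinite, one argues by induction on m using (In). The order of
   r_A r_B is then n.

   Admissibility is obtained as for the parabolic subgroups of a Coxeter group:
   by induction on the length k of w with respect to the r_A, if r_A w has
   length at least k, then A consists of left ascents of w. Given B with r_B w
   of length k - 1, write w = d v with d alternating in r_A, r_B, the lengths
   adding up and v as short as possible. By induction A and B consist of left
   ascents of v, which reduces the claim to d. *)
Require Import Defs.
From mathcomp Require Import all_boot.
From mathcomp Require Import boolp classical_sets functions cardinality.

Set Implicit Arguments.
Unset Strict Implicit.
Unset Printing Implicit Defensive.

Local Open Scope classical_set_scope.
Local Open Scope group_scope.

(** * Generated subgroups and alternating products of involutions *)

Lemma pres_cong_morph (X : Type) (R : seq X -> seq X -> Prop) (M : Type)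
    (f : seq X -> M) (op : M -> M -> M) :
    {morph f : u v / u ++ v >-> op u v} -> (forall u v, R u v -> f u = f v) ->
  forall u v, pres_cong R u v -> f u = f v.
Proof.
move=> fD fR u v; elim=> {u v} // [u v a b uv|u v w _ -> _ ->] //.
by rewrite !fD (fR u v).
Qed.

Section Involutions.
Variables (G : groupType).
Implicit Types (x y z : G) (A : set G).

Lemma invg_invol x : x * x = 1 -> x^-1 = x.
Proof. by move/mulg1_eq. Qed.

Lemma mulg_involK x : x * x = 1 -> cancel (mul x) (mul x).
Proof. by move=> xx y; rewrite mulgA xx mul1g. Qed.

Lemma subgroup_gen1 A : subgroup_gen A 1.
Proof. by move=> H [[/set_mem]]. Qed.

Lemma subgroup_genV A x : subgroup_gen A x -> subgroup_gen A x^-1.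
Proof.
move=> Ax H [gH AH]; apply/set_mem/(group_closedV gH)/mem_set.
exact: Ax.
Qed.

Lemma subgroup_genM A x y :
  subgroup_gen A x -> subgroup_gen A y -> subgroup_gen A (x * y).
Proof.
move=> Ax Ay H [gH AH]; apply/set_mem/(group_closedM gH); apply/mem_set.
  exact: Ax.
exact: Ay.
Qed.

Lemma subgroup_gen_mem A x : A x -> subgroup_gen A x.
Proof. by move=> Ax H [_]; apply. Qed.

Lemma subgroup_gen_sub A B : A `<=` B -> subgroup_gen A `<=` subgroup_gen B.
Proof. by move=> AB x Ax H [gH BH]; apply: Ax; split=> // y /AB /BH. Qed.

(** The [x] for which [K v] and [K (x * v)] are equivalent for all [v] form a subgroup; the
    equivalence gives closure under inverses. It contains [A] because the elements of [A] are
    involutions. *)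
Lemma subgroup_gen_invol_ind A (K : G -> Prop) :
    (forall a, A a -> a * a = 1) -> K 1 ->
    (forall a w, A a -> K w -> K (a * w)) ->
  forall w, subgroup_gen A w -> K w.
Proof.
move=> Ainv K1 KM w Aw; rewrite -[w]mulg1.
pose H := [set x | forall v, K v <-> K (x * v)].
suff: H w by move=> /(_ 1) [+ _]; apply.
apply: Aw; split; last first.
  move=> a Aa v; split; first exact: KM.
  by move/(KM _ _ Aa); rewrite mulg_involK ?Ainv.
split; first by apply/mem_set => v; rewrite mul1g.
move=> x y /set_mem Hx /set_mem Hy; apply/mem_set => v.
by rewrite -mulgA -Hx (Hy (y^-1 * v)) mulVKg.
Qed.

(** The number of factors is exact, not minimal; the length over [A] is the least such number. *)
Inductive prodn A : nat -> G -> Prop :=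
| Prodn0 : prodn A 0 1
| ProdnS n a w : A a -> prodn A n w -> prodn A n.+1 (a * w).

Lemma prodnM A m n x y :
  prodn A m x -> prodn A n y -> prodn A (m + n) (x * y).
Proof.
move=> px py; elim: px => [|k a w Aa _ IH]; first by rewrite mul1g.
by rewrite -mulgA addSn; apply: ProdnS.
Qed.

Lemma finite_prodn A n : finite_set A -> finite_set [set w | prodn A n w].
Proof.
move=> finA; elim: n => [|n IH].
  apply: (@sub_finite_set _ _ [set 1]) (finite_set1 1) => w.
  by move=> H; inversion H.
apply: (@sub_finite_set _ _ [set a * w | a in A & w in [set w | prodn A n w]]).
  by move=> w H; inversion H; subst; exists a => //; exists w0.
exact: finite_image2.
Qed.

Lemma prodn_altprod A n x y : A x -> A y -> prodn A n (altprod n x y).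
Proof.
elim: n x y => [|n IH] x y Ax Ay /=; first exact: Prodn0.
by apply: ProdnS => //; exact: IH.
Qed.

Lemma subgroup_gen_altprod A n x y :
  subgroup_gen A x -> subgroup_gen A y -> subgroup_gen A (altprod n x y).
Proof.
elim: n x y => [|n IH] x y Ax Ay /=; first exact: subgroup_gen1.
by apply: subgroup_genM => //; exact: IH.
Qed.

Lemma altprodD m n x y : altprod (m + n) x y =
  altprod m x y * (if odd m then altprod n y x else altprod n x y).
Proof.
elim: m x y => [|m IH] x y /=; first by rewrite mul1g.
by rewrite -mulgA IH; case: (odd m).
Qed.

Lemma altprodV n x y : x * x = 1 -> y * y = 1 ->
  (altprod n x y)^-1 = if odd n then altprod n x y else altprod n y x.
Proof.
move=> xx yy; elim: n => [|n IH]; first exact: invg1.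
rewrite -[in LHS]addn1 altprodD invgM IH /=.
by case: (odd n); rewrite mulg1 invg_invol.
Qed.

(** The last [n] letters of [(x * y) ^+ n] cancel against the factor on its right. *)
Lemma altprod_expg n x y : x * x = 1 -> y * y = 1 ->
  altprod n x y = (x * y) ^+ n * altprod n y x.
Proof.
elim: n x y => [|n IH] x y xx yy /=; first by rewrite mul1g.
rewrite (IH y x) // expgSr -!mulgA [y * (y * _)]mulg_involK // !mulgA.
congr (_ * _); elim: n {IH} => [|n IH]; first by rewrite mul1g mulg1.
by rewrite !expgS -!mulgA -IH !mulgA.
Qed.

Lemma expg_altprod n x y : x * x = 1 -> y * y = 1 ->
  (x * y) ^+ n = 1 <-> altprod n x y = altprod n y x.
Proof.
move=> xx yy; rewrite (altprod_expg n xx yy).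
by split=> [->|/(canRL (mulgK _))]; rewrite ?mul1g // mulgV.
Qed.

End Involutions.

(** * Reflections and the exchange condition *)

Section CoxeterExchange.
Variables (I : Type) (Gam : coxeterMatrix I).
Local Notation W := (coxeter_group Gam).
Local Notation g := (cox_gen Gam).
Local Notation len := (@cox_length I Gam).
Implicit Types (i j : I) (u v : seq I) (w x y t : W) (J : set I).

Lemma cox_gen2 i : g i * g i = 1.
Proof.
apply: etrans (esym (pres_wordM _ _ _)) _; apply/pres_wordP.
exact: (@PresRel _ _ _ _ [::] [::] (GrpRel (CoxeterSquare Gam i))).
Qed.

Lemma cox_genK i : cancel (mul (g i)) (mul (g i)).
Proof. exact/mulg_involK/cox_gen2. Qed.

Lemma cox_genV i : (g i)^-1 = g i.
Proof. exact/invg_invol/cox_gen2. Qed.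

Lemma cox_braid i j n :
  Gam i j = Some n -> altprod n (g i) (g j) = altprod n (g j) (g i).
Proof.
move=> ijn; apply: etrans (esym (pres_altword _ _ _ _)) _.
apply: etrans (pres_altword _ _ _ _); apply/pres_wordP.
have := @PresRel _ _ _ _ [::] [::] (GrpRel (CoxeterBraid ijn)).
by rewrite !cats0.
Qed.

Lemma cox_word0 : cox_word Gam [::] = 1.
Proof. by rewrite /cox_word big_nil. Qed.

Lemma cox_word_cons i u : cox_word Gam (i :: u) = g i * cox_word Gam u.
Proof. by rewrite /cox_word big_cons. Qed.

Lemma cox_word_cat u v :
  cox_word Gam (u ++ v) = cox_word Gam u * cox_word Gam v.
Proof. by rewrite /cox_word big_cat. Qed.

Lemma cox_word_altword n i j :
  cox_word Gam (altword n i j) = altprod n (g i) (g j).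
Proof.
by elim: n i j => [|n IH] i j /=; rewrite ?cox_word0 // cox_word_cons IH.
Qed.

Lemma cox_word_pres u :
  cox_word Gam u = pres_word _ [seq (i, true) | i <- u] :> W.
Proof.
elim: u => [|i u IH]; first by rewrite cox_word0.
by rewrite cox_word_cons IH; apply: esym; exact: (pres_wordM _ [:: _] _).
Qed.

(* For [u = s_1 ... s_n], the parity of the number of [k] such that
   [t = s_1 ... s_(k-1) s_k s_(k-1) ... s_1]. It depends only on the element
   represented by [u] (Bourbaki, Lie IV.1.4), which gives the exchange
   condition. *)
Fixpoint refl_parity u t : bool :=
  if u is i :: u' then (t == g i) (+) refl_parity u' (g i * t * g i) else false.

Lemma refl_parity_cat u v t : refl_parity (u ++ v) t =
  refl_parity u t (+) refl_parity v ((cox_word Gam u)^-1 * t * cox_word Gam u).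
Proof.
elim: u t => [|i u IH] t /=.
  by rewrite cox_word0 invg1 mul1g mulg1.
by rewrite IH addbA cox_word_cons invgM cox_genV !mulgA.
Qed.

(** The prefix of [k] letters conjugates the next letter to [(g i * g j) ^+ k * g i]. *)
Lemma refl_parity_altword m i j t : refl_parity (altword m i j) t =
  \big[addb/false]_(k < m) (t == (g i * g j) ^+ k * g i).
Proof.
elim: m i j t => [|m IH] i j t; first by rewrite big_ord0.
rewrite big_ord_recl /= mul1g IH; congr (_ (+) _); apply: eq_bigr => k _.
have comm n : g i * (g j * g i) ^+ n = (g i * g j) ^+ n * g i.
  elim: n => [|n IHn]; first by rewrite mulg1 mul1g.
  by rewrite [in LHS]expgSr mulgA IHn expgSr !mulgA.
have -> : (g i * g j) ^+ bump 0 k * g i = g i * ((g j * g i) ^+ k * g j) * g i.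
  by rewrite [g i * (_ * g j)]mulgA comm /bump add1n expgSr !mulgA.
apply/eqP/eqP => [<-|->].
  by rewrite !mulgA cox_gen2 mul1g -mulgA cox_gen2 mulg1.
by rewrite !mulgA cox_gen2 mul1g -!mulgA cox_gen2 mulg1.
Qed.

Lemma refl_parity_braid i j m :
  Gam i j = Some m ->
  refl_parity (altword m i j) =1 refl_parity (altword m j i).
Proof.
move=> /cox_braid /(expg_altprod m (cox_gen2 i) (cox_gen2 j)) ijm t.
(* As [(g i * g j) ^+ m = 1], both words have the same reflections, in opposite orders. *)
rewrite !refl_parity_altword (reindex_inj rev_ord_inj).
apply: eq_bigr => k _; congr (_ == _) => /=.
have -> : (g i * g j) ^+ (m - k.+1) = (g j * g i) ^+ k.+1.
  rewrite expgnFr // ijm mul1g -expVgn invgM.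
  by rewrite !cox_genV.
by rewrite expgSr -!mulgA cox_gen2 mulg1.
Qed.

Lemma refl_parity_eq u v : cox_word Gam u = cox_word Gam v ->
  refl_parity u =1 refl_parity v.
Proof.
rewrite !cox_word_pres => /pres_wordP.
(* With signs forgotten, free cancellations and squares both become [[:: i; i]]. *)
pose f (s : seq (I * bool)) :=
  (cox_word Gam (map fst s), refl_parity (map fst s)).
(* This is the product of a semidirect product, [W] acting on functions by conjugation. *)
pose op (p q : W * (W -> bool)) :=
  (p.1 * q.1, fun t => p.2 t (+) q.2 (p.1^-1 * t * p.1)).
move=> /(@pres_cong_morph _ _ _ f op) uv t.
have fE s : f [seq (i, true) | i <- s] = (cox_word Gam s, refl_parity s).
  by rewrite /f -map_comp map_id.
suff : f [seq (i, true) | i <- u] = f [seq (i, true) | i <- v].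
  by rewrite !fE => -[_ ->].
apply: uv => [s1 s2|].
  rewrite /f /op map_cat cox_word_cat; congr pair.
  by apply/funext => t'; rewrite refl_parity_cat.
have sq i : (cox_word Gam [:: i; i], refl_parity [:: i; i]) =
            (cox_word Gam [::], refl_parity [::]).
  rewrite !cox_word_cons cox_word0 mulg1 cox_gen2; congr pair.
  apply/funext => t' /=; rewrite addbF.
  have -> : (g i * t' * g i == g i) = (t' == g i); last exact: addbb.
  apply/eqP/eqP => [|->]; last by rewrite cox_gen2 mul1g.
  by rewrite -{3}[g i]mul1g => /mulIg /(canRL (cox_genK i)); rewrite mulg1.
move=> s1 s2 [i b|s s' [i|i j n ijn]]; [exact: sq|exact: sq|].
have fst_alt p q m : map fst (altword m p q) = altword m p.1 q.1 :> seq I.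
  by elim: m p q => //= m IH p q; rewrite IH.
rewrite /f !fst_alt /= !cox_word_altword (cox_braid ijn); congr pair.
exact/funext/refl_parity_braid.
Qed.

(** An odd count is positive, so [t] is some [s_1 ... s_k ... s_1]; multiplying by it deletes
    [s_k]. *)
Lemma refl_parity_delete u t : refl_parity u t ->
  exists u1 i u2,
    u = u1 ++ i :: u2 /\ t * cox_word Gam u = cox_word Gam (u1 ++ u2).
Proof.
elim: u t => //= i u IH t; case: (eqVneq t (g i)) => [-> _|_ /= /IH].
  by exists [::], i, u; rewrite cox_word_cons cox_genK.
move=> [u1 [j [u2 [-> e]]]]; exists (i :: u1), j, u2; split=> //=.
by rewrite !cox_word_cons -e !mulgA cox_gen2 mul1g.
Qed.

Lemma cox_length_le u : (len (cox_word Gam u) <= size u).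
Proof.
by rewrite /cox_length; case: ex_minnP => n _; apply; apply/asboolP; exists u.
Qed.

Lemma cox_length1 : len (1 : W) = 0%N.
Proof. by apply/eqP; rewrite -leqn0 -cox_word0; exact: cox_length_le. Qed.

Lemma cox_length_eq0 w : len w = 0%N -> w = 1.
Proof.
have [[|i u] [<- uw]] := reduced_word_ex w; first by rewrite cox_word0.
by rewrite -uw.
Qed.

Lemma cox_lengthM w x : (len (w * x) <= len w + len x).
Proof.
have [u [<- <-]] := reduced_word_ex w; have [v [<- <-]] := reduced_word_ex x.
by rewrite -cox_word_cat -size_cat cox_length_le.
Qed.

Lemma cox_lengthV w : len w^-1 = len w.
Proof.
suff le x : (len x^-1 <= len x) by apply/eqP; rewrite eqn_leq -{3}[w]invgK !le.
have [u [<- <-]] := reduced_word_ex x.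
suff -> : (cox_word Gam u)^-1 = cox_word Gam (rev u).
  by rewrite -size_rev cox_length_le.
elim: u => [|i u IH]; first by rewrite cox_word0 invg1.
rewrite cox_word_cons invgM IH cox_genV rev_cons -cats1 cox_word_cat.
by rewrite cox_word_cons cox_word0 mulg1.
Qed.

(** If the count for [u] is even, it is odd for [i :: u], hence for a reduced word of the same
    element. Deleting a letter there gives a word for [cox_word Gam u], which is therefore
    shorter. *)
Lemma refl_parity_gen i u :
  len (g i * cox_word Gam u) <= len (cox_word Gam u) -> refl_parity u (g i).
Proof.
apply: contraLR => upar; rewrite -ltnNge.
have [v [vw <-]] := reduced_word_ex (g i * cox_word Gam u).
rewrite -cox_word_cons in vw.
have : refl_parity v (g i).
  by rewrite (refl_parity_eq vw) /= eqxx cox_gen2 mul1g (negbTE upar).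
move=> /refl_parity_delete [v1 [j [v2 [vE]]]].
rewrite vw cox_word_cons cox_genK => ->.
by rewrite vE size_cat /= addnS ltnS -size_cat cox_length_le.
Qed.

Lemma refl_parity_lt u t : refl_parity u t -> len (t * cox_word Gam u) < size u.
Proof.
move=> /refl_parity_delete [u1 [i [u2 [-> ->]]]].
by rewrite size_cat /= addnS ltnS -size_cat cox_length_le.
Qed.

Lemma cox_exchange i x y : len (g i * (x * y)) <= len (x * y) ->
  len (g i * x) < len x \/ len (x^-1 * g i * x * y) < len y.
Proof.
have [u [<- <-]] := reduced_word_ex x; have [v [<- <-]] := reduced_word_ex y.
rewrite -cox_word_cat => /refl_parity_gen; rewrite refl_parity_cat.
case: (boolP (refl_parity u _)) => [|_ /=] /refl_parity_lt; first by left.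
by right.
Qed.

Lemma cox_length_genS i w : len (g i * w) <= (len w).+1.
Proof.
have [u [<- <-]] := reduced_word_ex w.
by rewrite -cox_word_cons (leq_trans (cox_length_le _)).
Qed.

Lemma cox_length_gen i w :
  len (g i * w) = (len w).+1 \/ (len (g i * w)).+1 = len w.
Proof.
have [le|lt] := leqP (len (g i * w)) (len w); last first.
  by left; apply/eqP; rewrite eqn_leq cox_length_genS.
right; apply/eqP; rewrite eqn_leq -{3}[w](cox_genK i) cox_length_genS andbT.
by have := @cox_exchange i w 1; rewrite !mulg1 cox_length1 ltn0 => /(_ le) [].
Qed.

Lemma cox_length_gen1 i : len (g i) = 1%N.
Proof. by case: (cox_length_gen i 1); rewrite mulg1 cox_length1. Qed.

Definition left_ascents w : set I := [set i | len (g i * w) = (len w).+1].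
Definition left_descents w : set I := [set i | (len (g i * w)).+1 = len w].

Lemma left_ascents_lt w i : len w < len (g i * w) -> left_ascents w i.
Proof. by case: (cox_length_gen i w) => // <-; rewrite ltnNge leqnSn. Qed.

Lemma left_descents_le w i : len (g i * w) <= len w -> left_descents w i.
Proof. by case: (cox_length_gen i w) => // ->; rewrite ltnn. Qed.

Lemma left_ascentsV w : left_ascents w^-1 = ascents w.
Proof.
apply/seteqP; split=> i; rewrite /left_ascents /ascents /=;
by rewrite -(cox_lengthV (w * _)) invgM cox_genV cox_lengthV.
Qed.

Lemma left_descentsV w : left_descents w^-1 = descents w.
Proof.
apply/seteqP; split=> i; rewrite /left_descents /descents /=;
by rewrite -(cox_lengthV (w * _)) invgM cox_genV cox_lengthV.
Qed.

(** * Parabolic subgroups and additivity of lengths *)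

Lemma parabolic_gen J i : J i -> @parabolic I Gam J (g i).
Proof. by move=> Ji; apply: subgroup_gen_mem; exists i. Qed.

Lemma parabolicS J K : J `<=` K -> @parabolic I Gam J `<=` @parabolic I Gam K.
Proof.
by move=> JK; apply: subgroup_gen_sub => _ [i Ji <-]; exists i; first exact: JK.
Qed.

(** When [g i] shortens [x], a letter of the reduced word at hand is deleted, so its letters stay in
    [J]. *)
Lemma parabolic_reduced_word J x : @parabolic I Gam J x ->
  exists2 u, all (fun i => i \in J) u & reduced_word_of x u.
Proof.
move: x.
apply: subgroup_gen_invol_ind => [_ [i _ <-]||_ x [i Ji <-] [u uJ [uw ul]]].
- exact: cox_gen2.
- by exists [::] => //; split; rewrite ?cox_word0 ?cox_length1.
case: (cox_length_gen i x) => l.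
  exists (i :: u); first by rewrite /= mem_set.
  by split; rewrite ?cox_word_cons ?uw //= ul l.
have /refl_parity_delete [u1 [j [u2 [uE e]]]] : refl_parity u (g i).
  by apply: refl_parity_gen; rewrite uw -l.
exists (u1 ++ u2).
  by move: uJ; rewrite uE !all_cat /= => /and3P [-> _ ->].
split; first by rewrite -e uw.
by apply: succn_inj; rewrite l -ul uE !size_cat /= addnS.
Qed.

Lemma parabolic_ind J (K : W -> Prop) : K 1 ->
    (forall i x, J i -> @parabolic I Gam J x -> left_ascents x i -> K x ->
      K (g i * x)) ->
  forall x, @parabolic I Gam J x -> K x.
Proof.
move=> K1 KM x /parabolic_reduced_word [u uJ [<-]].
suff H : size u = len (cox_word Gam u) ->
  @parabolic I Gam J (cox_word Gam u) /\ K (cox_word Gam u) by move=> /H [].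
elim: u uJ => [|i u IH] /=.
  by rewrite cox_word0; split=> //; exact: subgroup_gen1.
move=> /andP [/set_mem Ji uJ]; rewrite cox_word_cons => l.
have ul : size u = len (cox_word Gam u).
  apply/eqP; rewrite eqn_leq cox_length_le andbT -ltnS l.
  exact: cox_length_genS.
have [Ju Ku] := IH uJ ul; split; last first.
  by apply: KM => //; rewrite /left_ascents /= -l ul.
by apply: subgroup_genM => //; exact: parabolic_gen.
Qed.

(** If [g i] lengthens [x] but not [x * v], exchange acts in [v]: the element [x^-1 * g i * x] of
    [W_J] shortens [v], against minimality. *)
Lemma min_coset_additive J (v : W) :
    (forall x, @parabolic I Gam J x -> len v <= len (x * v)) ->
  forall x, @parabolic I Gam J x -> len (x * v) = len x + len v.
Proof.
move=> vmin x; elim/parabolic_ind => {x} [|i x Ji Jx xi IH].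
  by rewrite mul1g cox_length1.
rewrite xi addSn -IH -mulgA.
have [->//|ll] := cox_length_gen i (x * v).
case: (@cox_exchange i x v); rewrite -?ll // ?leqnSn // ?xi ?ltnNge ?leqnSn //.
rewrite vmin //; apply: subgroup_genM => //.
apply: subgroup_genM; first exact: subgroup_genV.
exact: parabolic_gen.
Qed.

(** Let [y * v] be shortest in the coset of [v]. If [y] were not 1, the first letter of a reduced
    word of [y^-1] would shorten [v = y^-1 * (y * v)]. Hence [v] itself is shortest. *)
Lemma left_ascents_additive J (v x : W) : J `<=` left_ascents v ->
  @parabolic I Gam J x -> len (x * v) = len x + len v.
Proof.
move=> Jv; apply: min_coset_additive => {x}.
have ex : exists n, `[< exists2 y, @parabolic I Gam J y & len (y * v) = n >].
  by exists (len (1 * v)); apply/asboolP; exists 1 => //; exact: subgroup_gen1.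
case: (ex_minnP ex) => n /asboolP [y Jy <-] nmin.
have v0add : forall x, @parabolic I Gam J x ->
    len (x * (y * v)) = len x + len (y * v).
  apply: min_coset_additive => x Jx; apply: nmin; apply/asboolP.
  by exists (x * y); [exact: subgroup_genM|rewrite mulgA].
have Jy' := subgroup_genV Jy.
have [[|i u] uJ [uy ul]] := parabolic_reduced_word Jy'.
  move=> x Jx; apply: leq_trans (_ : len (y * v) <= _).
    by rewrite -[y]invgK -uy cox_word0 invg1 mul1g.
  by apply: nmin; apply/asboolP; exists x.
move: uJ => /= /andP [/set_mem Ji _]; have := Jv i Ji.
rewrite /left_ascents /= -{1 2}[v](mulKg y) mulgA !v0add //; last first.
  by apply: subgroup_genM => //; exact: parabolic_gen.
rewrite -addSn => /addIn; rewrite -ul -uy cox_word_cons cox_genK => e.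
by have := cox_length_le u; rewrite e /= ltnNge leqnSn.
Qed.

(** In the induction, [g i] shortens [w = y * (y^-1 * w)] but lengthens [y], so by exchange
    [y^-1 * g i * w] is shorter than [y^-1 * w]. *)
Lemma left_descents_additive J w y : J `<=` left_descents w ->
  @parabolic I Gam J y -> len w = len y + len (y^-1 * w).
Proof.
move=> Jw; elim/parabolic_ind => {y} [|i y Ji Jy yi IH].
  by rewrite invg1 mul1g cox_length1.
apply/eqP; rewrite eqn_leq -{1}[w](mulVKg (g i * y)) cox_lengthM /=.
have := @cox_exchange i y (y^-1 * w); rewrite mulVKg -(Jw i Ji) leqnSn.
move=> /(_ isT) []; first by rewrite yi ltnNge leqnSn.
rewrite -[_ * (_ * w)]mulgA mulVKg Jw // IH yi addSnnS leq_add2l.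
by rewrite invgM cox_genV.
Qed.

(* [left_descents_additive] bounds the length on [W_J] by [len w], so [W_J]
   consists of bounded products of finitely many generators. *)
Lemma left_descents_spherical J w : finite_set (g @` J) ->
  J `<=` left_descents w -> @spherical I Gam J.
Proof.
move=> finJ Jw.
apply: (@sub_finite_set _ _
    (\bigcup_(n in `I_(len w).+1) [set y | prodn (g @` J) n y])); last first.
  by apply: bigcup_finite (finite_II _) _ => n _; exact: finite_prodn.
move=> y Jy; exists (len y) => /=.
  by rewrite ltnS (left_descents_additive Jw Jy) leq_addr.
elim/parabolic_ind: y / Jy => [|i y Ji _ yi].
  by rewrite cox_length1; exact: Prodn0.
by rewrite yi; apply: ProdnS; exists i.
Qed.

(** * Longest elements *)

Lemma spherical_finite_gen J : @spherical I Gam J -> finite_set (g @` J).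
Proof. by apply: sub_finite_set => _ [i Ji <-]; exact: parabolic_gen. Qed.

Lemma longestP J : @spherical I Gam J -> parabolic J (longest Gam J) /\
  forall w, parabolic J w -> len w <= len (longest Gam J).
Proof.
move=> finJ; rewrite /longest.
set S : set W := [set w | _]; suff: exists w, S w by move=> /(xgetPex 1).
have [s sJ] : exists s : seq W, parabolic J = [set` s] by exact/finite_seqP.
have le w : parabolic J w -> len w <= \max_(x <- s) len x.
  by rewrite sJ => ws; exact: leq_bigmax_seq.
have ex : exists n, `[< exists2 w, @parabolic I Gam J w & len w = n >].
  by exists (len 1); apply/asboolP; exists 1 => //; exact: subgroup_gen1.
have ub n : `[< exists2 w, @parabolic I Gam J w & len w = n >] ->
    n <= \max_(x <- s) len x.
  by move=> /asboolP [v /le ? <-].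
case: (ex_maxnP ex ub) => n /asboolP [w Jw <-] wmax; exists w; split=> // x Jx.
by apply: wmax; apply/asboolP; exists x.
Qed.

Section Longest.
Variables (J : set I) (sJ : @spherical I Gam J).
Local Notation r := (longest Gam J).

Lemma longest_parabolic : parabolic J r.
Proof. by have [] := longestP sJ. Qed.

Lemma longest_descents : J `<=` left_descents r.
Proof.
have [Jr rmax] := longestP sJ => i Ji; apply/left_descents_le/rmax.
by apply: subgroup_genM => //; exact: parabolic_gen.
Qed.

(** Splitting [r^-1], which is as long as [r], off [r] leaves [r * r] with length 0. *)
Lemma longest2 : r * r = 1.
Proof.
have Jr' := subgroup_genV longest_parabolic.
have := left_descents_additive longest_descents Jr'.
by rewrite cox_lengthV invgK -{1}[len r]addn0 => /addnI /esym /cox_length_eq0.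
Qed.

Lemma longest_mul_length w :
  J `<=` left_ascents w -> len (r * w) = len r + len w.
Proof. by move=> Jw; apply: left_ascents_additive Jw longest_parabolic. Qed.

Lemma longest_mul_descents w :
  J `<=` left_ascents w -> J `<=` left_descents (r * w).
Proof.
move=> Jw i Ji; rewrite /left_descents /= longest_mul_length // mulgA.
rewrite (left_ascents_additive Jw) -?addSn ?(longest_descents Ji) //.
by apply: subgroup_genM longest_parabolic; exact: parabolic_gen.
Qed.

(** Split [r * w] as [(r * g i) * (g i * w)]: the first factor is shorter than [r], so the second is
    longer than [w]. *)
Lemma longest_mul_ascents w :
  len (r * w) = len r + len w -> J `<=` left_ascents w.
Proof.
move=> e i Ji; apply: left_ascents_lt.
have /(_ i Ji) ri : J `<=` descents r.
  by rewrite -left_descentsV (invg_invol longest2); exact: longest_descents.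
have := cox_lengthM (r * g i) (g i * w); rewrite -mulgA cox_genK e -ri addSn.
by rewrite -addnS leq_add2l.
Qed.

End Longest.

Lemma left_ascents_descents J w : J !=set0 ->
  J `<=` left_ascents w -> J `<=` left_descents w -> False.
Proof.
move=> [i Ji] /(_ i Ji) ui /(_ i Ji); rewrite /left_descents /= ui.
by move=> /eqP; rewrite -[_ == _]/((len w).+2 == len w) gtn_eqF.
Qed.

(** * The Artin monoid and pairs of parts *)

Lemma artin_word_eq u v : artin_word Gam u = artin_word Gam v ->
  cox_word Gam u = cox_word Gam v /\ size u = size v.
Proof.
have artinE s : artin_word Gam s = pres_word _ s.
  rewrite /artin_word; elim: s => [|i s IH]; first by rewrite big_nil.
  by rewrite big_cons IH; apply: esym; exact: (pres_wordM _ [:: i] s).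
rewrite !artinE => /pres_wordP uv; split.
  apply: (pres_cong_morph cox_word_cat) uv => _ _ [i j n ijn].
  by rewrite !cox_word_altword (cox_braid ijn).
apply: (pres_cong_morph (@size_cat I)) uv => _ _ [i j n _].
have sz m (p q : I) : size (altword m p q) = m.
  by elim: m p q => //= m IH p q; rewrite IH.
by rewrite !sz.
Qed.

Fixpoint altsum n (a b : nat) : nat :=
  if n is n'.+1 then (a + altsum n' b a)%N else 0%N.

(** The reduced words chosen for [x] and [y], concatenated, equal the one for [z] in the monoid;
    braid relations preserve both the image in [W] and the size. *)
Lemma artin_lift_altprod n x y z :
    artin_lift z = altprod n (artin_lift x) (artin_lift y) ->
  z = altprod n x y /\ len z = altsum n (len x) (len y).
Proof.
rewrite /artin_lift; case: (cid (reduced_word_ex x)) => u [/= ux ul].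
case: (cid (reduced_word_ex y)) => v [/= vy vl].
case: (cid (reduced_word_ex z)) => s [/= <- <-].
rewrite -ul -vl -ux -vy.
have [s' [<- <- <-]] : exists s', [/\ artin_word Gam s' =
    altprod n (artin_word Gam u) (artin_word Gam v),
    cox_word Gam s' = altprod n (cox_word Gam u) (cox_word Gam v) &
    size s' = altsum n (size u) (size v)].
  elim: n u v {ux ul vy vl} => [|n IH] u v /=.
    by exists [::]; split; rewrite ?cox_word0 // /artin_word big_nil.
  have [s' [<- <- <-]] := IH v u; exists (u ++ s').
  by rewrite cox_word_cat size_cat /artin_word big_cat.
exact: artin_word_eq.
Qed.

Lemma altsum_le n x y : len (altprod n x y) <= altsum n (len x) (len y).
Proof.
elim: n x y => [|n IH] x y /=; first by rewrite cox_length1.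
by apply: leq_trans (cox_lengthM _ _) _; rewrite leq_add2l.
Qed.

(** Additivity passes to the product without its first factor, which starts with the other element;
    this is why both orders occur. *)
Lemma altsum_lt n x y m :
    len (altprod n x y) = altsum n (len x) (len y) ->
    len (altprod n y x) = altsum n (len y) (len x) -> m < n ->
  len (x * altprod m y x) = (len x + len (altprod m y x))%N.
Proof.
elim: n x y => // n IH x y xn yn; rewrite ltnS leq_eqVlt.
have tail a b : len (altprod n.+1 a b) = altsum n.+1 (len a) (len b) ->
    len (altprod n b a) = altsum n (len b) (len a).
  move=> e; apply/eqP; rewrite eqn_leq altsum_le /= -(leq_add2l (len a)).
  by rewrite -[(_ + altsum _ _ _)%N]e cox_lengthM.
case: eqP => [-> _|_ /=]; last by apply: IH; exact: tail.
by rewrite (tail _ _ xn).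
Qed.

Definition lt_infty m (o : option nat) : bool :=
  if o is Some n then m < n else true.

(* (Fi) when the entry [o] is finite, (In) when it is [None]. *)
Definition lcm_pair (A B : set I) (o : option nat) : Prop :=
  if o is Some n then
    @spherical I Gam (A `|` B) /\
    artin_longest Gam (A `|` B) =
      altprod n (artin_longest Gam A) (artin_longest Gam B)
  else forall i, A i -> ~ @spherical I Gam ([set i] `|` B).

Section LcmPair.
Variables (A B : set I) (o : option nat).
Hypotheses (sA : @spherical I Gam A) (sB : @spherical I Gam B).
Hypotheses (AB : lcm_pair A B o) (BA : lcm_pair B A o).
Local Notation a := (longest Gam A).
Local Notation b := (longest Gam B).

(** Both products are the longest element for the union of [A] and [B]. *)
Lemma lcm_pair_braid n : o = Some n -> altprod n a b = altprod n b a.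
Proof.
move=> on; move: AB BA; rewrite on /= (setUC B).
by move=> [_ /artin_lift_altprod [<- _]] [_ /artin_lift_altprod []].
Qed.

Lemma lcm_pair_ascents m : lt_infty m o ->
  A `<=` left_ascents (altprod m b a).
Proof.
case: o AB BA => [n|] /=.
  rewrite (setUC B) => -[_ /artin_lift_altprod [e1 l1]].
  move=> [_ /artin_lift_altprod [e2 l2]] mn.
  by apply: longest_mul_ascents => //; apply: (@altsum_lt n); rewrite -?e1 -?e2.
move=> ABn BAn _.
(* If [i] in [A] were a left descent of [b a b ...], then [{i} `|` B] would
   consist of left descents, hence be spherical. *)
suff /(_ m) [] : forall m, A `<=` left_ascents (altprod m b a) /\
   B `<=` left_ascents (altprod m a b) by [].
(* Each of the two statements for [k.+1] follows from the other one for [k]. *)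
have step J K k : @spherical I Gam J -> @spherical I Gam K ->
    (forall i, J i -> ~ @spherical I Gam ([set i] `|` K)) ->
    K `<=` left_ascents (altprod k (longest Gam J) (longest Gam K)) ->
  J `<=` left_ascents (altprod k.+1 (longest Gam K) (longest Gam J)).
  move=> sJ sK JK Ka i Ji; apply: left_ascents_lt; rewrite ltnNge; apply/negP.
  move=> /left_descents_le ile; apply: (JK i Ji).
  apply: (@left_descents_spherical _
    (altprod k.+1 (longest Gam K) (longest Gam J))).
    rewrite image_setU finite_setU image_set1; split; first exact: finite_set1.
    exact: spherical_finite_gen.
  by move=> j [->//|]; exact: longest_mul_descents.
elim=> [|k [IHa IHb]]; last by split; exact: step.
by split=> i _; rewrite /left_ascents /= mulg1 cox_length_gen1 cox_length1.
Qed.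

(** If [(a * b) ^+ k = 1], the two alternating products of [k] factors agree. For [0 < k] below [o],
    [A] would consist of left ascents of one and of left descents of the other. *)
Lemma lcm_pair_order : A !=set0 -> o <> Some 0%N -> elt_order (a * b) = o.
Proof.
move=> A0 o0.
have aa := longest2 sA; have bb := longest2 sB.
have big k : (0 < k)%N -> (a * b) ^+ k = 1 ->
    ~ lt_infty k o.
  case: k => // k _ /(expg_altprod _ aa bb) e kn.
  have up := lcm_pair_ascents kn.
  apply: (left_ascents_descents A0 up).
  rewrite -e; apply: longest_mul_descents => //; apply: lcm_pair_ascents.
  by case: o kn => // n; exact: ltnW.
have fin n : o = Some n -> (0 < n)%N && ((a * b) ^+ n == 1).
  move=> on; apply/andP; split.
    by rewrite lt0n; apply/eqP => n0; rewrite on n0 in o0.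
  exact/eqP/(expg_altprod _ aa bb)/lcm_pair_braid.
rewrite /elt_order; case: pselect => [ex|nex]; last first.
  by case: o fin => // n /(_ n erefl) on; case: nex; exists n.
case: ex_minnP => k /andP [k0 /eqP /(big k k0)].
case: o fin => [n|] //= /(_ n erefl) on /negP; rewrite -leqNgt => nk kmin.
by congr Some; apply/eqP; rewrite eqn_leq nk kmin.
Qed.

End LcmPair.

End CoxeterExchange.

(** * Admissibility *)

Section PartitionGroup.
Variables (I : Type) (Gam : coxeterMatrix I) (P : set (set I)).
Local Notation W := (coxeter_group Gam).
Local Notation g := (cox_gen Gam).
Local Notation len := (@cox_length I Gam).
Implicit Types (w x y : W) (A B : set I).
Hypothesis sphP : forall A, P A -> @spherical I Gam A.
Hypothesis lcmP : forall A B, P A -> P B ->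
  exists o, [/\ o <> Some 0%N, lcm_pair Gam A B o & lcm_pair Gam B A o].
Local Notation r := (longest Gam).
Local Notation T := (r @` P).

Lemma partition_ascents n w A : P A -> prodn T n w ->
    (forall j, j < n -> ~ prodn T j w) ->
    (forall j, j < n -> ~ prodn T j (r A * w)) ->
  A `<=` left_ascents w.
Proof.
elim/ltn_ind: n w A => n IH w A PA wn wmin Awmin.
case: n IH wn wmin Awmin => [|n] IH wn wmin Awmin.
  inversion wn => i _.
  by rewrite /left_ascents /= mulg1 cox_length_gen1 cox_length1.
have [B PB Bwn] : exists2 B, P B & prodn T n (r B * w).
  inversion wn as [|? b w' [B PB <-] w'n e0 e1].
  by exists B => //; rewrite mulg_involK //; apply/longest2/sphP.
have TA : T (r A) by exists A.
have TB : T (r B) by exists B.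
have AA := longest2 (sphP PA); have BB := longest2 (sphP PB).
have prodw k i C D x : T C -> T D -> prodn T i x ->
    prodn T (k + i) (altprod k C D * x).
  by move=> TC TD; apply: prodnM; exact: prodn_altprod.
(* [m] is the length, over the [r C], of [v] in a decomposition [w = d v] with
   [d] alternating in [r A], [r B] and lengths adding up; the least [m] makes
   [A `|` B] ascents of [v]. *)
pose Q m := exists2 j, (m + j)%N = n.+1 &
  prodn T m (altprod j (r A) (r B) * w) \/
  prodn T m (altprod j (r B) (r A) * w).
have exQ : exists m, `[< Q m >].
  by exists n; apply/asboolP; exists 1%N; rewrite ?addn1 //= !mulg1; right.
case: (ex_minnP exQ) => m /asboolP [j mj vm] mmin.
have mn : m < n.+1.
  rewrite ltnS; apply: mmin; apply/asboolP.
  by exists 1%N; rewrite ?addn1 //= !mulg1; right.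
have {vm} [v vm vE] : exists2 v, prodn T m v &
    v = altprod j (r A) (r B) * w \/ v = altprod j (r B) (r A) * w.
  by case: vm; eexists; eauto.
have inv C D x y : C * C = 1 -> D * D = 1 -> y = altprod j C D * x ->
    x = altprod j C D * y \/ x = altprod j D C * y.
  move=> CC DD ->; have := altprodV j CC DD.
  by case: odd => e; [left|right]; rewrite -[LHS](mulKg (altprod j C D)) e.
have wE : w = altprod j (r A) (r B) * v \/ w = altprod j (r B) (r A) * v.
  by case: vE => /inv [] //; [left|right|right|left].
have vmin i : i < m -> ~ prodn T i v.
  move=> im vi; apply: (wmin (j + i)%N); first by rewrite -mj addnC ltn_add2r.
  by case: wE => ->; exact: prodw.
have up C D : T C -> T D -> C * C = 1 -> D * D = 1 ->
    v = altprod j C D * w \/ v = altprod j D C * w ->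
    (forall i, prodn T i (altprod j.+1 C D * w) -> (i + j.+1)%N = n.+1 ->
      m <= i) ->
  forall i, i < m -> ~ prodn T i (C * v).
  move=> TC TD CC DD vE' hm i im Cvi.
  have im1 : i.+1 = m.
    apply/eqP; rewrite eqn_leq im leqNgt; apply/negP => /vmin; apply.
    by rewrite -[v](mulg_involK CC); exact: ProdnS.
  case: vE' => vE'; last first.
    have : m <= i by apply: hm; rewrite /= -?mulgA -?vE' // addnS -addSn im1.
    by rewrite leqNgt im.
  move: mj vE'; case: (j) => [|k] mk.
    by rewrite addn0 in mk; rewrite mk ltnn in mn.
  move=> vE'; rewrite vE' /= -mulgA mulg_involK // in Cvi.
  apply: (wmin (k + i)%N).
    by rewrite -mk -im1 addSn addnS addnC ltnS leqnSn.
  rewrite -[w](mulKg (altprod k D C)) altprodV //.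
  by case: odd; exact: prodw.
have Av : A `<=` left_ascents v.
  apply: (IH m) => //; apply: (up _ (r B)) => // i Qi ij.
  by apply: mmin; apply/asboolP; exists j.+1 => //; left.
have Bv : B `<=` left_ascents v.
  apply: (IH m) => //; apply: (up _ (r A)) => // [|i Qi ij].
    by case: vE; [right|left].
  by apply: mmin; apply/asboolP; exists j.+1 => //; right.
have j0 : (0 < j)%N by rewrite -(ltn_add2l m) addn0 mj.
have wE' : w = altprod j (r B) (r A) * v.
  case: wE => // wE; case: (Awmin (j.-1 + m)%N).
    by rewrite -mj addnC ltn_add2l prednK.
  have -> : r A * w = altprod j.-1 (r B) (r A) * v; last exact: prodw.
  by rewrite wE -[in LHS](prednK j0) /= -mulgA mulg_involK.
have [o [o0 AB BA]] := lcmP PA PB.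
have jo : lt_infty j o.
  case oE: o => [k|] //=; rewrite ltnNge; apply/negP => kj.
  have k0 : (0 < k)%N by rewrite lt0n; apply/eqP => k0; rewrite oE k0 in o0.
  have br := lcm_pair_braid AB BA oE.
  case: (Awmin (k.-1 + ((j - k) + m))%N).
    rewrite addnA -mj [(m + j)%N]addnC ltn_add2r -{2}(subnKC kj).
    by rewrite ltn_add2r prednK.
  rewrite wE' -{2}(subnKC kj) altprodD !mulgA.
  have -> : r A * altprod k (r B) (r A) = altprod k.-1 (r B) (r A).
    by rewrite -br -[in LHS](prednK k0) /= mulg_involK.
  rewrite -mulgA.
  by apply: (prodw) => //; case: odd; exact: prodw.
move=> i Ai; rewrite /left_ascents /= wE' mulgA.
have ABv : A `|` B `<=` left_ascents v by rewrite subUset.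
have Jd : @parabolic I Gam (A `|` B) (altprod j (r B) (r A)).
  have lp C : P C -> C `<=` A `|` B -> @parabolic I Gam (A `|` B) (r C).
    move=> PC CAB; apply: (parabolicS CAB); apply: longest_parabolic.
    exact: sphP.
  apply: subgroup_gen_altprod.
    by apply: lp => //; exact: subsetUr.
  by apply: lp => //; exact: subsetUl.
rewrite !(left_ascents_additive ABv) //; last first.
  by apply: subgroup_genM Jd; apply: parabolic_gen; left.
by rewrite (lcm_pair_ascents (sphP PA) (sphP PB) AB BA jo Ai).
Qed.

Lemma partition_group_admissible w A : partition_group P w -> P A ->
  A `<=` ascents w \/ A `<=` descents w.
Proof.
move=> Pw PA; rewrite -left_ascentsV -left_descentsV.
have TT b : T b -> b * b = 1 by move=> [B /sphP sB <-]; exact: longest2.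
have min_prodn n x : prodn T n x ->
    exists k, [/\ k <= n, prodn T k x & forall j, j < k -> ~ prodn T j x].
  move=> xn; have ex : exists n, `[< prodn T n x >] by exists n; apply/asboolP.
  case: (ex_minnP ex) => k /asboolP xk kmin; exists k; split=> // [|j].
    by apply/kmin/asboolP.
  by rewrite ltnNge => /negP jk xj; apply/jk/kmin/asboolP.
have [n /min_prodn [k [_ wk kmin]]] : exists n, prodn T n w^-1.
  move: (w^-1) (subgroup_genV Pw).
  apply: (subgroup_gen_invol_ind TT) => [|b x Tb [n xn]].
    by exists 0%N; exact: Prodn0.
  by exists n.+1; exact: ProdnS.
case: (pselect (exists2 j, j < k & prodn T j (r A * w^-1))) => [[j jk]|nex].
  move=> /min_prodn [l [lj rwl lmin]]; right.
  have rw : r A * (r A * w^-1) = w^-1.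
    by rewrite mulg_involK //; apply: TT; exists A.
  rewrite -rw; apply: longest_mul_descents; first exact: sphP.
  apply: (partition_ascents PA rwl lmin) => m ml; rewrite rw; apply: kmin.
  exact: ltn_trans (leq_ltn_trans lj jk).
left; apply: (partition_ascents PA wk kmin) => j jk rwj; apply: nex.
by exists j.
Qed.

End PartitionGroup.

Theorem theorem33 (I : Type) (Gam : coxeterMatrix I) (P : set (set I))
    (Om : coxeterMatrix P) :
  LCM_partition Gam Om ->
  admissible_partition Gam P /\
  forall alpha beta : P, Om alpha beta = partition_matrix Gam alpha beta.
Proof.
move=> [sP OmP]; have [[_ _ P0] sphP] := sP.
have lcmO (a b : P) : lcm_pair Gam (val a) (val b) (Om a b).
  by have [[n [-> sab rab]]|[-> ninf]] := OmP a b.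
split; last first.
  move=> a b; have Pa := set_valP a; have Pb := set_valP b.
  rewrite /partition_matrix (lcm_pair_order _ _ (lcmO a b)) //.
  - exact: sphP.
  - exact: sphP.
  - by rewrite coxeter_sym; exact: lcmO.
  - exact: P0.
  - exact: coxeter_gt0.
split=> // w A Pw PA; apply: (partition_group_admissible sphP _ Pw PA).
move=> B C PB PC; exists (Om (SigSub (mem_set PB)) (SigSub (mem_set PC))).
split; [exact: coxeter_gt0|exact: lcmO|by rewrite coxeter_sym; exact: lcmO].
Qed.
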